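(* Let $\mathfrak{g}_0$ be a compact semisimple real Lie algebra, $U$ a finite dimensional real $\mathfrak{g}_0$-module, $V=U^{\mathbb{C}}$, $\mathfrak{g}=\mathfrak{g}_0^{\mathbb{C}}$, $\mathfrak{h}_0$ a maximal abelian subalgebra of $\mathfrak{g}_0$, $\mathfrak{h}=\mathfrak{h}_0^{\mathbb{C}}$, and $\Lambda$ the set of nonzero weights of $V$ relative to $\mathfrak{h}$. Let $\Lambda^+$ be any subset of $\Lambda$ such that $\Lambda$ is the disjoint union of $\Lambda^+$ and $-\Lambda^+$. Then $$U=U_0+\sum_{\lambda\in\Lambda^+}U_\lambda\qquad\text{(direct sum)}.$$ If $\langle\,,\rangle$ is any inner product on $U$ such that the elements of $\mathfrak{g}_0\subset\mathrm{End}(U)$ are skew symmetric, then this decomposition of $U$ is an orthogonal direct sum decomposition.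
   Context: A compact semisimple real Lie algebra is one whose Killing form is negative definite; then $\mathfrak{h}$ is a Cartan subalgebra of $\mathfrak{g}$. $V_\lambda=\{v\in V:Hv=\lambda(H)v\ \forall H\in\mathfrak{h}\}$, $V_0$ is the zero weight space, and $\Lambda=\{\lambda\in\mathrm{Hom}(\mathfrak{h},\mathbb{C}):\lambda\ne0,\ V_\lambda\neq\{0\}\}$ (one has $-\Lambda=\Lambda$). The real weight spaces are $U_\lambda=(V_\lambda\oplus V_{-\lambda})\cap U$ for $\lambda\in\Lambda$ and $U_0=V_0\cap U$. *)

(* Defs.v *)
From HB Require Import structures.
From mathcomp Require Import all_boot all_order all_algebra.
From mathcomp Require Export sesquilinear complex.
From mathcomp Require Import ring.
From mathcomp Require Import boolp classical_sets functions cardinality reals.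

Set Implicit Arguments.
Unset Strict Implicit.
Unset Printing Implicit Defensive.

Import Order.TTheory GRing.Theory Num.Theory.

Local Open Scope ring_scope.
Local Open Scope classical_set_scope.

(* [P] is read as a subspace; the value is junk ([0%VS]) if it is not one,
   which [mem_vspace_of] excludes at each use. *)
Definition vspace_of (K : fieldType) (V : vectType K) (P : set V) :
  {vspace V} := xget 0%VS [set W : {vspace V} | forall v, v \in W <-> P v].

Lemma mem_vspace_of (K : fieldType) (V : vectType K) (P : set V) :
    P 0 -> (forall a u v, P u -> P v -> P (a *: u + v)) ->
  forall v, v \in vspace_of P <-> P v.
Proof.
move=> P0 PD.
suff [W WP] : exists W : {vspace V}, forall v, v \in W <-> P v.
  pose S := [set X : {vspace V} | forall v, v \in X <-> P v].
  exact: (@xgetPex _ 0%VS S (ex_intro S W WP)).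
pose Q := [pred n | `[< exists2 W : {vspace V},
                   \dim W = n & forall v, v \in W -> P v >]].
have Q0 : exists n, Q n.
  exists 0%N; apply/asboolP; exists 0%VS; first exact: dimv0.
  by move=> v; rewrite memv0 => /eqP->.
have Qub n : Q n -> (n <= \dim {:V})%N.
  by move=> /asboolP[W <- _]; rewrite dimvS ?subvf.
case: (ex_maxnP Q0 Qub) => n /asboolP[W dimW WP] nmax.
exists W => v; split=> [/WP//|Pv]; apply/negPn/negP => vW.
have /nmax : Q (\dim (W + <[v]>)%VS).
  apply/asboolP; exists (W + <[v]>)%VS => // x.
  by move=> /memv_addP[w /WP Pw [_ /vlineP[a ->] ->]]; rewrite addrC; exact: PD.
rewrite -dimW => leW; move/negP: vW; apply.
have /eqP -> : W == (W + <[v]>)%VS by rewrite eqEdim addvSl.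
by apply: (subvP (addvSr _ _)); exact: memv_line.
Qed.

HB.mixin Record isLieAlgebra (K : fieldType) g of Vector K g := {
  lie : g -> g -> g;
  lie_linearr : forall x, linear (lie x);
  lie_linearl : forall y, linear (lie^~ y);
  liexx : forall x, lie x x = 0;
  lie_jacobi : forall x y z,
    lie x (lie y z) + lie y (lie z x) + lie z (lie x y) = 0
}.

#[short(type="lieAlgType")]
HB.structure Definition LieAlgebra (K : fieldType) :=
  { g of isLieAlgebra K g & Vector K g }.

Definition endo_trace (K : fieldType) (V : vectType K) (f : 'End(V)) : K :=
  \tr (passmx.mxof (vbasis {:V}) (vbasis {:V}) f).

Definition ad (K : fieldType) (g : lieAlgType K) (x : g) : 'End(g) :=
  linfun (lie x).

Definition killing (K : fieldType) (g : lieAlgType K) (x y : g) : K :=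
  endo_trace (ad x \o ad y)%VF.

Definition compact_semisimple (R : realFieldType) (g : lieAlgType R) :=
  forall x : g, x != 0 -> killing x x < 0.

Section Subalgebras.
Variables (K : fieldType) (g : lieAlgType K).

Definition is_subalgebra (h : {vspace g}) :=
  forall x y, x \in h -> y \in h -> lie x y \in h.

Definition is_abelian (h : {vspace g}) :=
  forall x y, x \in h -> y \in h -> lie x y = 0.

Definition maximal_abelian_subalgebra (h : {vspace g}) :=
  [/\ is_subalgebra h, is_abelian h &
      forall k : {vspace g}, is_subalgebra k -> is_abelian k ->
        (h <= k)%VS -> k = h].

End Subalgebras.

Record lieRep (K : fieldType) (g : lieAlgType K) (V : vectType K) := LieRep {
  rep_act :> g -> 'End(V);
  rep_linear : linear rep_act;
  rep_lie : forall x y v,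
    rep_act (lie x y) v = rep_act x (rep_act y v) - rep_act y (rep_act x v)
}.

Section Weights.
Variables (K : fieldType) (g : lieAlgType K) (V : vectType K).
Variables (rho : lieRep g V) (h : {vspace g}).
Implicit Types l : 'Hom(subvs_of h, K^o).

Definition weight_space l : {vspace V} := vspace_of
  [set v | forall H : subvs_of h, rho (vsval H) v = l H *: v].

Lemma mem_weight_space l v :
  v \in weight_space l <->
  forall H : subvs_of h, rho (vsval H) v = l H *: v.
Proof.
apply: (mem_vspace_of (P := [set v | forall H, rho (vsval H) v = l H *: v])).
  by move=> H; rewrite linear0 scaler0.
by move=> a u w /= Pu Pw H; rewrite linearP /= Pu Pw scalerDr !scalerA mulrC.
Qed.

Definition nonzero_weights : set 'Hom(subvs_of h, K^o) :=
  [set l | l != 0 /\ weight_space l != 0%VS].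

End Weights.
Arguments nonzero_weights {K g V} rho h.

(* [Cplx u v] stands for u + iv in the complexification of U. *)
Record cplx (U : Type) := Cplx { cre : U; cim : U }.

Section ComplexificationChoice.
Variable U : Type.
Definition pair_of_cplx (z : cplx U) := (cre z, cim z).
Definition cplx_of_pair (p : U * U) := Cplx p.1 p.2.
Lemma pair_of_cplxK : cancel pair_of_cplx cplx_of_pair. Proof. by case. Qed.
End ComplexificationChoice.

HB.instance Definition _ (U : eqType) :=
  Equality.copy (cplx U) (can_type (@pair_of_cplxK U)).
HB.instance Definition _ (U : choiceType) :=
  Choice.copy (cplx U) (can_type (@pair_of_cplxK U)).

Lemma cplxP (U : Type) (z w : cplx U) : cre z = cre w -> cim z = cim w -> z = w.
Proof. by case: z w => [a b] [c d] /= -> ->. Qed.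

Section ComplexificationZmodule.
Variable U : zmodType.
Implicit Types z w : cplx U.
Definition cplx_add z w := Cplx (cre z + cre w) (cim z + cim w).
Definition cplx_opp z := Cplx (- cre z) (- cim z).
Fact cplx_addA : associative cplx_add.
Proof. by move=> x y z; rewrite /cplx_add /= !addrA. Qed.
Fact cplx_addC : commutative cplx_add.
Proof. by move=> x y; rewrite /cplx_add addrC [cim _ + _]addrC. Qed.
Fact cplx_add0 : left_id (Cplx 0 0) cplx_add.
Proof. by case=> a b; rewrite /cplx_add /= !add0r. Qed.
Fact cplx_addN : left_inverse (Cplx 0 0) cplx_opp cplx_add.
Proof. by case=> a b; rewrite /cplx_add /= !addNr. Qed.
HB.instance Definition _ := GRing.isZmodule.Build (cplx U)
  cplx_addA cplx_addC cplx_add0 cplx_addN.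
End ComplexificationZmodule.

Section ComplexificationVector.
Variables (R : realFieldType).

Section Lmodule.
Variable U : lmodType R.
Implicit Types (a b : R[i]) (z w : cplx U).
Definition cplx_scale a z :=
  Cplx (complex.Re a *: cre z - complex.Im a *: cim z)
       (complex.Re a *: cim z + complex.Im a *: cre z).
Fact cplx_scaleA a b z : cplx_scale a (cplx_scale b z) = cplx_scale (a * b) z.
Proof.
case: a b z => [a a'] [b b'] [u v]; rewrite /cplx_scale /=; congr Cplx;
rewrite !scalerDr !scalerDl !scalerN !scalerA !scaleNr.
  by rewrite !opprD -!addrA; congr (_ + _); rewrite [RHS]addrC addrA.
by rewrite -!addrA; congr (_ + _); rewrite [RHS]addrC addrA.
Qed.
Fact cplx_scale1 : left_id 1 cplx_scale.
Proof.
by case=> u v; rewrite /cplx_scale /= !scale1r !scale0r subr0 addr0.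
Qed.
Fact cplx_scaleDr : right_distributive cplx_scale +%R.
Proof.
move=> a z w; apply: cplxP; rewrite /= !scalerDr ?opprD;
by rewrite addrACA.
Qed.
Fact cplx_scaleDl z : {morph cplx_scale^~ z : a b / a + b}.
Proof.
move=> [a a'] [b b']; apply: cplxP; rewrite /= !scalerDl ?opprD;
by rewrite addrACA.
Qed.
HB.instance Definition _ := GRing.Zmodule_isLmodule.Build R[i] (cplx U)
  cplx_scaleA cplx_scale1 cplx_scaleDr cplx_scaleDl.
End Lmodule.

Section FinDim.
Variable U : vectType R.
Import VectorInternalTheory.

Let crv (z : cplx U) : 'rV[R[i]]_(dim U) :=
  \row_j (Complex (v2r (cre z) 0 j) (v2r (cim z) 0 j)).

Fact cplx_vector : Vector.axiom (dim U) (cplx U).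
Proof.
exists crv.
  move=> [a b] z w; apply/rowP=> j.
  by rewrite !mxE /= !linearD !linearN !linearZ /= !mxE mulrN.
exists (fun r : 'rV[R[i]]_(dim U) => Cplx (r2v (\row_j complex.Re (r 0 j)))
                                          (r2v (\row_j complex.Im (r 0 j)))).
  by move=> z; apply: cplxP => /=; apply: v2r_inj; rewrite r2vK;
    apply/rowP=> j; rewrite !mxE.
by move=> r; apply/rowP=> j; rewrite !mxE /= !r2vK !mxE; case: (r 0 j).
Qed.

HB.instance Definition _ := Lmodule_hasFinDim.Build R[i] (cplx U) cplx_vector.
End FinDim.

End ComplexificationVector.

Section Coordinates.
Import VectorInternalTheory.
Variables (K : fieldType) (V : vectType K).
Implicit Types u v : V.
Let co u j : K := v2r u 0 j.
Fact vcoordP u v : (forall j, co u j = co v j) -> u = v.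
Proof. by move=> E; apply: v2r_inj; apply/rowP. Qed.
Fact vcoord0 j : co 0 j = 0.
Proof. by rewrite /co linear0 mxE. Qed.
Fact vcoordD j u v : co (u + v) j = co u j + co v j.
Proof. by rewrite /co linearD mxE. Qed.
Fact vcoordN j u : co (- u) j = - co u j.
Proof. by rewrite /co linearN mxE. Qed.
Fact vcoordZ j a u : co (a *: u) j = a * co u j.
Proof. by rewrite /co linearZ mxE. Qed.
End Coordinates.

Ltac vring :=
  apply: vcoordP => ?; rewrite ?(vcoord0, vcoordD, vcoordN, vcoordZ); ring.

Section ComplexifiedLieAlgebra.
Variables (R : realFieldType) (g : lieAlgType R).
Implicit Types x y z : cplx g.

(* The R[i]-bilinear extension of the bracket. *)
Definition cplx_lie x y :=
  Cplx (lie (cre x) (cre y) - lie (cim x) (cim y))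
       (lie (cre x) (cim y) + lie (cim x) (cre y)).

Let lieDr (u v w : g) : lie u (v + w) = lie u v + lie u w.
Proof. by have := lie_linearr u 1 v w; rewrite !scale1r. Qed.
Let lieDl (u v w : g) : lie (v + w) u = lie v u + lie w u.
Proof. by have := lie_linearl u 1 v w; rewrite !scale1r. Qed.
Let lie0r (u : g) : lie u 0 = 0.
Proof. by apply: (addrI (lie u 0)); rewrite -lieDr !addr0. Qed.
Let lie0l (u : g) : lie 0 u = 0.
Proof. by apply: (addrI (lie 0 u)); rewrite -lieDl !addr0. Qed.
Let lieZr a (u v : g) : lie u (a *: v) = a *: lie u v.
Proof. by have := lie_linearr u a v 0; rewrite !addr0 lie0r addr0. Qed.
Let lieZl a (u v : g) : lie (a *: v) u = a *: lie v u.
Proof. by have := lie_linearl u a v 0; rewrite !addr0 lie0l addr0. Qed.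
Let lieNr (u v : g) : lie u (- v) = - lie u v.
Proof. by rewrite -scaleN1r lieZr scaleN1r. Qed.
Let lieNl (u v : g) : lie (- v) u = - lie v u.
Proof. by rewrite -scaleN1r lieZl scaleN1r. Qed.
Let lieC (u v : g) : lie u v = - lie v u.
Proof.
apply/eqP; rewrite -addr_eq0; have /eqP := liexx (u + v).
by rewrite lieDr !lieDl !liexx add0r addr0 addrC.
Qed.

Fact cplx_lie_linearr x : linear (cplx_lie x).
Proof.
move=> [a b] y z; apply: cplxP; rewrite /= !(lieDr, lieNr, lieZr).
  vring.
vring.
Qed.

Fact cplx_lie_linearl y : linear (cplx_lie^~ y).
Proof.
move=> [a b] x z; apply: cplxP; rewrite /= !(lieDl, lieNl, lieZl).
  vring.
vring.
Qed.

Fact cplx_liexx x : cplx_lie x x = 0.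
Proof.
by apply: cplxP; rewrite /= ?liexx ?subrr // [X in _ + X]lieC subrr.
Qed.

Fact cplx_lie_jacobi x y z :
  cplx_lie x (cplx_lie y z) + cplx_lie y (cplx_lie z x)
    + cplx_lie z (cplx_lie x y) = 0.
Proof.
have E (u v w : g) : lie u (lie v w) = - lie v (lie w u) - lie w (lie u v).
  by apply/eqP; rewrite -opprD -addr_eq0 addrA lie_jacobi.
apply: cplxP; rewrite /= !(lieDr, lieNr).
  rewrite (E (cre x) (cre y) (cre z)) (E (cre x) (cim y) (cim z)).
  rewrite (E (cim x) (cre y) (cim z)) (E (cim x) (cim y) (cre z)).
  vring.
rewrite (E (cre x) (cre y) (cim z)) (E (cre x) (cim y) (cre z)).
rewrite (E (cim x) (cre y) (cre z)) (E (cim x) (cim y) (cim z)).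
vring.
Qed.

HB.instance Definition _ := isLieAlgebra.Build R[i] (cplx g)
  cplx_lie_linearr cplx_lie_linearl cplx_liexx cplx_lie_jacobi.

End ComplexifiedLieAlgebra.

Section ComplexifiedModule.
Variables (R : realFieldType) (g : lieAlgType R) (U : vectType R).
Variable rho : lieRep g U.

(* (x + ix')(v + iv') = (xv - x'v') + i(xv' + x'v). *)
Definition cplx_act (x : cplx g) (v : cplx U) : cplx U :=
  Cplx (rho (cre x) (cre v) - rho (cim x) (cim v))
       (rho (cre x) (cim v) + rho (cim x) (cre v)).

Let rho0 : rho 0 = 0.
Proof.
by have := rep_linear rho (-1) 0 0; rewrite scaler0 addr0 scaleN1r addNr.
Qed.
Let rhoP a x y u : rho (a *: x + y) u = a *: rho x u + rho y u.
Proof. by rewrite rep_linear !lfunE /= !lfunE. Qed.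
Let rhoD x y u : rho (x + y) u = rho x u + rho y u.
Proof. by rewrite -[x in LHS]scale1r rhoP scale1r. Qed.
Let rhoZ a x u : rho (a *: x) u = a *: rho x u.
Proof. by rewrite -[_ *: x]addr0 rhoP rho0 zero_lfunE addr0. Qed.
Let rhoN x u : rho (- x) u = - rho x u.
Proof. by rewrite -scaleN1r rhoZ scaleN1r. Qed.

Fact cplx_act_linear x : linear (cplx_act x).
Proof.
move=> [a b] v w; apply: cplxP; rewrite /= !(linearD, linearN, linearZ) /=.
  vring.
vring.
Qed.

HB.instance Definition _ x := GRing.isLinear.Build R[i] (cplx U) (cplx U) *:%R
  (cplx_act x) (cplx_act_linear x).

Definition cplx_rep_fun (x : cplx g) : 'End(cplx U) := linfun (cplx_act x).

Fact cplx_rep_funE x v : cplx_rep_fun x v = cplx_act x v.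
Proof. exact: lfunE. Qed.

Fact cplx_rep_linear : linear cplx_rep_fun.
Proof.
move=> [a b] x y; apply/lfunP=> v.
rewrite add_lfunE scale_lfunE !cplx_rep_funE.
apply: cplxP; rewrite /= !(rhoD, rhoN, rhoZ).
  vring.
vring.
Qed.

Fact cplx_rep_lie x y v : cplx_rep_fun (lie x y) v =
  cplx_rep_fun x (cplx_rep_fun y v) - cplx_rep_fun y (cplx_rep_fun x v).
Proof.
rewrite !cplx_rep_funE; apply: cplxP;
rewrite /= !(rhoD, rhoN, rep_lie, linearD, linearN) /=.
  vring.
vring.
Qed.

Definition cplx_rep : lieRep (cplx g) (cplx U) :=
  LieRep cplx_rep_linear cplx_rep_lie.

End ComplexifiedModule.

Section RealForm.
Variables (R : realFieldType) (U : vectType R).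

Definition cplx_subspace (W : {vspace U}) : {vspace cplx U} :=
  vspace_of [set z | cre z \in W /\ cim z \in W].

Lemma mem_cplx_subspace (W : {vspace U}) z :
  z \in cplx_subspace W <-> cre z \in W /\ cim z \in W.
Proof.
apply: (mem_vspace_of (P := [set z : cplx U | cre z \in W /\ cim z \in W])).
  by split; exact: mem0v.
by move=> [a b] u v /= [? ?] [? ?]; split;
  rewrite memvD // ?memvB ?memvD // memvZ.
Qed.

(* [W :&: U], with U embedded in its complexification as u + i0. *)
Definition real_subspace (W : {vspace cplx U}) : {vspace U} :=
  vspace_of [set u | Cplx u 0 \in W].

Lemma mem_real_subspace (W : {vspace cplx U}) u :
  u \in real_subspace W <-> Cplx u 0 \in W.
Proof.
apply: (mem_vspace_of (P := [set u | Cplx u 0 \in W])); first exact: mem0v.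
move=> a v w /= vW wW.
have -> : Cplx (a *: v + w) 0 = Complex a 0 *: Cplx v 0 + Cplx w 0.
  by apply: cplxP; rewrite /= ?scaler0 ?scale0r ?subr0 ?addr0.
by rewrite memvD ?memvZ.
Qed.

End RealForm.

Section RealWeights.
Variables (R : realFieldType) (g : lieAlgType R) (U : vectType R).
Variables (rho : lieRep g U) (h : {vspace g}).

Definition cplx_weight := 'Hom(subvs_of (cplx_subspace h), R[i]^o).

Definition cplx_weight_space (l : cplx_weight) : {vspace cplx U} :=
  weight_space (cplx_rep rho) l.

Definition cplx_weights : set cplx_weight :=
  nonzero_weights (cplx_rep rho) (cplx_subspace h).

Definition real_weight_space (l : cplx_weight) : {vspace U} :=
  real_subspace (cplx_weight_space l + cplx_weight_space (- l)).

Definition real_zero_weight_space : {vspace U} :=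
  real_subspace (cplx_weight_space 0).

End RealWeights.
Arguments cplx_weights {R g U} rho h.
Arguments real_zero_weight_space {R g U} rho h.

Definition skew_module (R : realFieldType) (g : lieAlgType R) (U : vectType R)
    (rho : lieRep g U) (ip : {dot U for idfun}) :=
  forall x u v, ip (rho x u) v = - ip u (rho x v).

Definition orthogonal_subspaces (R : realFieldType) (U : vectType R)
    (ip : {dot U for idfun}) (V W : {vspace U}) :=
  forall v w, v \in V -> w \in W -> ip v w = 0.

(* Main.v *)
Require Import Defs.
From HB Require Import structures.
From mathcomp Require Import all_boot all_order all_algebra.
From mathcomp Require Import finmap sesquilinear complex.
From mathcomp Require Import ring lra.
From mathcomp Require Import boolp classical_sets functions cardinality reals.

Set Implicit Arguments.
Unset Strict Implicit.
Unset Printing Implicit Defensive.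

Import Order.TTheory GRing.Theory Num.Theory.
Import passmx.

Local Open Scope ring_scope.
Local Open Scope classical_set_scope.

(** Everything follows from one fact: the elements of [h0] act on the
    complexification of [U] by commuting diagonalizable endomorphisms with
    imaginary eigenvalues. Indeed a weight [l] that is imaginary on [h0]
    satisfies [conj (V l) = V (- l)], so the real and imaginary parts of a
    vector of [V l] belong to the real weight space of [l]; since the weight
    spaces span the complexification, the real weight spaces span [U]
    ([imaginary_weight_vectors_span], [imaginary_weight_vectorP]). The sum is
    direct because vectors of distinct weights are independent
    ([eigenvector_notin_sum]); and for an invariant inner product, extended
    bilinearly, [V l] and [V m] are orthogonal unless [m = - l].

    The usual proof of that fact integrates over a compact group to make the
    action skew for some inner product on [U]. The argument below is algebraic
    and goes through sl2.

    For the adjoint action an invariant inner product is at hand, namely minus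
    the Killing form, so [ad v] is diagonalizable with imaginary eigenvalues
    for every [v]. A root vector [x + iy] of [h0] therefore satisfies
    [[v, x] = - a(v) y] and [[v, y] = a(v) x] with [a(v)] real, and
    [t := [x, y]] centralizes [h0], so is in [h0] by maximality. If [t] is not
    zero, then [x, y, t] span a copy of su(2). The identity
    [killing v t = - a(v) * killing y y] shows that an element of [h0]
    orthogonal to all these [t] is killed by all roots, thus is central,
    thus is zero: the generators [t] span [h0] ([su2_triples_span]).

    In any finite-dimensional representation, a complexified su(2) acts through
    an sl2-triple whose semisimple element is an imaginary multiple of [t]. That
    this element is diagonalizable with integer eigenvalues is proved by hand
    ([sl2_semisimple], [sl2_eigenvalue]), by following strings of vectors. *)

(** * Eigenspaces of commuting endomorphisms *)

Lemma exists_eigenvector (K : numClosedFieldType) (V : vectType K)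
    (f : 'End(V)) (W : {vspace V}) :
    W != 0%VS -> (forall v, v \in W -> f v \in W) ->
  exists a v, [/\ v \in W, v != 0 & f v = a *: v].
Proof.
move=> W0 fW; set E := subvs_of W.
pose g : 'End(E) := (linfun (vsproj W) \o f \o linfun vsval)%VF.
have b : basis_of {:E} (vbasis {:E}) by exact: vbasisP.
have dW : (0 < \dim {:E})%N by rewrite dimvf /dim /= lt0n dimv_eq0.
have [a] := eigenvalue_closed (mxof (vbasis {:E}) (vbasis {:E}) g) dW.
move=> /eigenvalueP[r rg r0].
pose w := vecof (vbasis {:E}) r.
exists a, (vsval w); split; first exact: subvsP.
  have : w != 0 by rewrite vecof_eq0 ?basis_free.
  by apply: contra_neq => w0; apply: val_inj.
have : g w = a *: w by rewrite /w (@hom_vecof _ _ _ _ _ b) rg linearZ.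
rewrite /g !comp_lfunE !lfunE /= => /(congr1 vsval).
by rewrite vsprojK ?fW ?subvsP.
Qed.

(** Fitting: once some member [T] of the family is not scalar on an invariant
    subspace [W] and [a] is one of its eigenvalues there, the hypothesis on
    double kernels makes [W] the sum of the proper invariant subspaces
    [W :&: ker (T - a)] and [(T - a) W]. *)
Lemma common_eigenvectors_span (K : numClosedFieldType) (V : vectType K)
    (I : Type) (F : I -> 'End(V)) (S : {vspace V}) :
    (forall i j v, F i (F j v) = F j (F i v)) ->
    (forall i a v, F i (F i v - a *: v) = a *: (F i v - a *: v) ->
       F i v = a *: v) ->
    (forall v, v != 0 -> (forall i, exists a, F i v = a *: v) -> v \in S) ->
  S = fullv.
Proof.
move=> FC Fss FS; apply/eqP; rewrite eqEsubv subvf /=.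
suff H n (W : {vspace V}) : (\dim W <= n)%N ->
    (forall i v, v \in W -> F i v \in W) -> (W <= S)%VS.
  by apply: (H (\dim {:V})) => // i v _; exact: memvf.
elim: n W => [|n IH] W.
  by rewrite leqn0 dimv_eq0 => /eqP-> _; exact: sub0v.
move=> dW FW; have [->|W0] := eqVneq W 0%VS; first exact: sub0v.
have [sc|] :=
    pselect (forall i, exists a, forall v, v \in W -> F i v = a *: v).
  apply/subvP => v vW; have [->|v0] := eqVneq v 0; first exact: mem0v.
  by apply: FS => // i; have [a Ha] := sc i; exists a; exact: Ha.
move=> /existsNP[i /forallNP nsc].
have [a [w [wW w0 Fw]]] := exists_eigenvector W0 (FW i).
pose T : 'End(V) := F i - a *: \1%VF.
have TE v : T v = F i v - a *: v by rewrite /T !lfun_simp.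
have Tker v : (v \in lker T) = (F i v == a *: v).
  by rewrite memv_ker TE subr_eq0.
have FT j v : F j (T v) = T (F j v) by rewrite !TE linearB linearZ /= FC.
have dKI := limg_ker_dim T W.
have K0 : (0 < \dim (W :&: lker T))%N.
  rewrite lt0n dimv_eq0; apply/eqP => /vspaceP/(_ w).
  by rewrite memv_cap wW Tker Fw eqxx memv0 (negPf w0).
have I0 : (0 < \dim (T @: W))%N.
  rewrite lt0n dimv_eq0 -lkerE; apply/negP => /subvP WT.
  by apply: (nsc a) => v /WT; rewrite Tker => /eqP.
have KS : (W :&: lker T <= S)%VS.
  apply: IH => [|j v].
    by rewrite -ltnS (leq_trans _ dW)// -dKI -[X in (X < _)%N]addn0 ltn_add2l.
  rewrite !memv_cap => /andP[vW]; rewrite !memv_ker -FT => /eqP->.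
  by rewrite linear0 eqxx FW.
have IS : (T @: W <= S)%VS.
  apply: IH => [|j v].
    by rewrite -ltnS (leq_trans _ dW)// -dKI -[X in (X < _)%N]add0n ltn_add2r.
  by move=> /memv_imgP[u uW ->]; rewrite FT memv_img// FW.
suff <- : (W :&: lker T + T @: W)%VS = W by rewrite subv_add KS IS.
apply/eqP; rewrite eqEdim dimv_disjoint_sum ?dKI ?leqnn ?andbT.
  rewrite subv_add capvSl /=; apply/subvP => _ /memv_imgP[u uW ->].
  by rewrite TE memvB ?FW ?memvZ.
apply/eqP; rewrite -subv0; apply/subvP => x; rewrite !memv_cap memv0.
move=> /andP[/andP[_ xK] /memv_imgP[u uW xE]].
by move: xK; rewrite xE Tker TE => /eqP/Fss ->; rewrite subrr.
Qed.

Lemma subv_sum_seq (K : fieldType) (X : vectType K) (T : eqType) (s : seq T)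
    (W : T -> {vspace X}) t : t \in s -> (W t <= \sum_(r <- s) W r)%VS.
Proof. by move=> ts; rewrite (big_rem t ts) addvSl. Qed.

Lemma sum_seq_subv (K : fieldType) (X : vectType K) (T : eqType) (s : seq T)
    (W : T -> {vspace X}) (S : {vspace X}) :
  (forall t, t \in s -> W t <= S)%VS -> (\sum_(t <- s) W t <= S)%VS.
Proof.
move=> WS; rewrite big_seq; elim/big_ind: _ => //; first exact: sub0v.
by move=> A B AS BS; rewrite subv_add AS.
Qed.

Section SimultaneousEigenspaces.
Variables (K : fieldType) (V : vectType K) (I : Type) (F : I -> 'End(V)).
Variables (T : eqType) (w : T -> I -> K) (W : T -> {vspace V}).
Hypothesis w_sep : forall l m, l != m -> exists i, w l i != w m i.
Hypothesis FW : forall l v, v \in W l -> forall i, F i v = w l i *: v.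

Lemma sum_eigenspaces_stable s v i :
  v \in (\sum_(l <- s) W l)%VS -> F i v \in (\sum_(l <- s) W l)%VS.
Proof.
elim: s v => [|l s IH] v; rewrite ?big_nil ?big_cons.
  by rewrite memv0 => /eqP->; rewrite linear0 mem0v.
move=> /memv_addP[a aW [b bW ->]].
by rewrite linearD /= memv_add ?IH // (FW aW) memvZ.
Qed.

(** Applying [F i - w m i] to a relation removes its [m]-component and scales
    the component [v] of weight [l] by [w l i - w m i], which is not zero for
    a suitable [i]. *)
Lemma eigenvector_notin_sum s l v : l \notin s ->
  (forall i, F i v = w l i *: v) -> v \in (\sum_(m <- s) W m)%VS -> v = 0.
Proof.
elim: s v => [|m s IH] v; rewrite ?big_nil ?big_cons.
  by rewrite memv0 => _ _ /eqP.
rewrite inE negb_or => /andP[/w_sep[i lm] ls] Fv /memv_addP[a aW [b bW vE]].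
have : (w l i - w m i) *: v = 0.
  apply: IH => // [j|]; first by rewrite linearZ /= Fv !scalerA mulrC.
  suff -> : (w l i - w m i) *: v = F i b - w m i *: b.
    by rewrite memvB ?sum_eigenspaces_stable ?memvZ.
  rewrite scalerBl -Fv vE linearD /= (FW aW) scalerDr opprD.
  by rewrite addrACA subrr add0r.
by move=> /eqP; rewrite scaler_eq0 subr_eq0 (negPf lm) => /eqP.
Qed.

Lemma dim_sum_eigenspaces s : uniq s ->
  \dim (\sum_(l <- s) W l) = (\sum_(l <- s) \dim (W l))%N.
Proof.
elim: s => [|l s IH]; first by rewrite !big_nil dimv0.
rewrite cons_uniq => /andP[ls us]; rewrite !big_cons -IH//.
apply/dimv_disjoint_sum/eqP; rewrite -subv0; apply/subvP => v.
rewrite memv_cap memv0 => /andP[vl vs]; apply/eqP.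
by apply: (eigenvector_notin_sum ls _ vs); exact: FW.
Qed.

Lemma size_eigenspaces s : uniq s -> (forall l, l \in s -> W l != 0%VS) ->
  (size s <= \dim {:V})%N.
Proof.
move=> us Wn; apply: (@leq_trans (\dim (\sum_(l <- s) W l)));
  last by rewrite dimvS ?subvf.
rewrite dim_sum_eigenspaces // -sum1_size big_seq [X in (_ <= X)%N]big_seq.
by apply: leq_sum => l /Wn; rewrite lt0n dimv_eq0.
Qed.

End SimultaneousEigenspaces.

(** * Representations of sl2 *)

Section Sl2.
Variables (K : numFieldType) (V : vectType K).
Implicit Types (e f h : 'End(V)) (v : V) (mu : K).

Definition sl2_triple e f h := [/\
  forall v, h (e v) = e (h v) + 2 *: e v,
  forall v, h (f v) = f (h v) - 2 *: f v &
  forall v, e (f v) = f (e v) + h v].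

Lemma sl2_triple_opp e f h : sl2_triple e f h -> sl2_triple f e (- h).
Proof.
case=> he hf ef; split=> v; rewrite !opp_lfunE.
- by rewrite hf linearN opprB addrC.
- by rewrite he linearN opprD.
- by rewrite ef addrK.
Qed.

Lemma iter_lfunP f n a u v :
  iter n f (a *: u + v) = a *: iter n f u + iter n f v.
Proof. by elim: n => //= n ->; rewrite linearP. Qed.

Lemma iter_lfun0 f n : iter n f 0 = 0.
Proof. by elim: n => //= n ->; rewrite linear0. Qed.

Lemma iter_lfunZ f n a u : iter n f (a *: u) = a *: iter n f u.
Proof. by rewrite -[a *: u]addr0 iter_lfunP iter_lfun0 addr0. Qed.

Section Triple.
Variables (e f h : 'End(V)).
Hypothesis T : sl2_triple e f h.
Let he v : h (e v) = e (h v) + 2 *: e v. Proof. by case: T. Qed.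
Let hf v : h (f v) = f (h v) - 2 *: f v. Proof. by case: T. Qed.
Let ef v : e (f v) = f (e v) + h v. Proof. by case: T. Qed.

Lemma sl2_weight_raise n v :
  h (iter n e v) = iter n e (h v) + (n.*2)%:R *: iter n e v.
Proof.
elim: n => [|n IH]; first by rewrite scale0r addr0.
by rewrite !iterS he IH linearD linearZ /= -addrA -scalerDl -natrD addn2.
Qed.

Lemma sl2_weight_lower n v :
  h (iter n f v) = iter n f (h v) - (n.*2)%:R *: iter n f v.
Proof.
elim: n => [|n IH]; first by rewrite scale0r subr0.
rewrite !iterS hf IH linearB linearZ /= -addrA -opprD -scalerDl -natrD.
by rewrite addn2.
Qed.

Lemma sl2_raise_lower n v : e (iter n.+1 f v) =
  iter n.+1 f (e v) + n.+1%:R *: (iter n f (h v) - n%:R *: iter n f v).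
Proof.
elim: n => [|n IH]; first by rewrite /= ef scale0r subr0 scale1r.
rewrite [iter n.+2 f v]iterS ef IH sl2_weight_lower linearD linearZ linearB.
rewrite linearZ /= -!addrA; congr (_ + _).
rewrite -!scaleNr !scalerDr !scalerA addrACA.
rewrite -[X in _ + X + _]scale1r -!scalerDl; congr (_ *: _ + _ *: _).
  by rewrite natr1.
by rewrite -addnn -!natr1 !natrD -!natr1; ring.
Qed.

(** The vectors [iter n e v] are eigenvectors for distinct eigenvalues, and
    there is no room for more than [\dim V] of them. *)
Lemma sl2_raise_nilpotent mu v : h v = mu *: v -> exists n, iter n e v = 0.
Proof.
move=> hv; apply: contrapT => /forallNP nz.
suff : (size (iota 0 (\dim {:V}).+1) <= \dim {:V})%N by rewrite size_iota ltnn.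
apply: (size_eigenspaces (F := fun _ : unit => h)
  (w := fun n _ => mu + (n.*2)%:R) (W := fun n => <[iter n e v]>%VS)).
- move=> l m lm; exists tt.
  by rewrite (inj_eq (addrI mu)) eqr_nat -!muln2 eqn_pmul2r.
- move=> l _ /vlineP[a ->] _.
  by rewrite linearZ /= sl2_weight_raise hv iter_lfunZ -scalerDl !scalerA mulrC.
- exact: iota_uniq.
- move=> l _; apply/negP => /eqP l0; apply: (nz l).
  by apply/eqP; rewrite -memv0 -l0 memv_line.
Qed.

End Triple.

Lemma sl2_lower_nilpotent e f h mu v : sl2_triple e f h ->
  h v = mu *: v -> exists n, iter n f v = 0.
Proof.
move=> /sl2_triple_opp T hv; apply: (sl2_raise_nilpotent T (mu := - mu)).
by rewrite opp_lfunE hv scaleNr.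
Qed.

Section Semisimple.
Variables (e f h : 'End(V)).
Hypothesis T : sl2_triple e f h.

(** The last nonzero vector [iter n f v] of the string is sent by [e \o f] both
    to [0] and to a multiple of [(mu - n) *: iter n f v]. *)
Lemma sl2_highest_weight mu v : v != 0 -> e v = 0 -> h v = mu *: v ->
  exists n, [/\ mu = n%:R, iter n f v != 0 & iter n.+1 f v = 0].
Proof.
move=> v0 ev hv; have [N fN] := sl2_lower_nilpotent T hv.
have ex : exists n, iter n f v == 0 by exists N; apply/eqP.
case: (ex_minnP ex) => -[|n] /eqP fn0 min; first by case/eqP: v0.
have fn : iter n f v != 0 by apply/negP => /min; rewrite ltnn.
exists n; split=> //; apply/eqP; rewrite -subr_eq0.
have := sl2_raise_lower T n v.
rewrite fn0 linear0 ev iter_lfun0 add0r hv iter_lfunZ -scalerBl => /esym/eqP.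
by rewrite !scaler_eq0 pnatr_eq0 (negPf fn) orbF.
Qed.

Lemma sl2_eigenvalue mu v : v != 0 -> h v = mu *: v ->
  exists m n : nat, mu = m%:R - n%:R.
Proof.
move=> v0 hv; have [N eN] := sl2_raise_nilpotent T hv.
have ex : exists n, iter n e v == 0 by exists N; apply/eqP.
case: (ex_minnP ex) => -[|n] /eqP en0 min; first by case/eqP: v0.
have en : iter n e v != 0 by apply/negP => /min; rewrite ltnn.
have := sl2_weight_raise T n v; rewrite hv iter_lfunZ -scalerDl.
move=> /(sl2_highest_weight en en0)[m [mE _ _]].
by exists m, n.*2; rewrite -mE addrK.
Qed.

(** For [mu = n] and [w := h v - mu *: v != 0] the string of [w] stops after
    [iter n f w]. Then so does that of [v], because
    [e (iter j.+1 f v)] is a nonzero multiple of [iter j f v] for [j > n]; and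
    at [j = n] the same formula gives [iter n f w = 0]. *)
Lemma sl2_semisimple_ker mu v : e v = 0 ->
  h (h v - mu *: v) = mu *: (h v - mu *: v) -> h v = mu *: v.
Proof.
case: (T) => he _ _ ev; set w := h v - mu *: v => hw.
have hv : h v = mu *: v + w by rewrite addrC subrK.
have ew : e w = 0.
  apply/eqP; have := he v; rewrite ev linear0 scaler0 addr0 => /esym ehv.
  by rewrite /w linearB linearZ /= ehv ev scaler0 subrr.
apply/eqP; rewrite -subr_eq0 -/w; apply/negPn/negP => w0.
have [n [muE fnw fSw]] := sl2_highest_weight w0 ew hw.
have step j : e (iter j.+1 f v) =
    j.+1%:R *: ((mu - j%:R) *: iter j f v + iter j f w).
  rewrite (sl2_raise_lower T) ev iter_lfun0 add0r hv iter_lfunP.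
  by rewrite scalerBl addrAC.
have fw j : (n < j)%N -> iter j f w = 0.
  by move=> nj; rewrite -(subnK nj) iterD fSw iter_lfun0.
have [M fM] : exists M, iter M f (iter n.+1 f v) = 0.
  apply: (sl2_lower_nilpotent T (mu := mu - (n.+1.*2)%:R)).
  by rewrite (sl2_weight_lower T) hv iter_lfunP fw // addr0 scalerBl.
have {M fM} fv : iter n.+1 f v = 0.
  elim: M fM => // M IH fM; apply: IH; rewrite -iterD.
  have /eqP := step (M + n.+1)%N.
  rewrite -addSn iterD fM linear0 fw ?leq_addl // addr0 eq_sym.
  rewrite !scaler_eq0 pnatr_eq0 addSn /= muE subr_eq0 eqr_nat.
  by rewrite ltn_eqF ?leq_addl //= => /eqP.
have /eqP := step n; rewrite fv linear0 muE subrr scale0r add0r eq_sym.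
by rewrite scaler_eq0 pnatr_eq0 (negPf fnw).
Qed.

(** With [t j := iter j f (iter j e u)] and [d j := j.+1 * (nu + j)], which is
    not zero since [nu > 0], one has
    [e (iter j.+1 f (iter j e u)) = t j.+1 + d j *: t j]. As [t j = 0] for large
    [j], every [t j], in particular [u], is in the image of [e]. *)
Lemma sl2_raise_surjective nu u : 0 < nu -> h u = nu *: u ->
  exists y, e y = u /\ h y = (nu - 2) *: y.
Proof.
move=> nu0 hu; have [N eN] := sl2_raise_nilpotent T hu.
suff H n j : (N <= n + j)%N ->
    exists y, e y = iter j f (iter j e u) /\ h y = (nu - 2) *: y.
  by apply: (H N 0%N); rewrite addn0.
elim: n j => [|n IH] j Nj.
  rewrite add0n in Nj; exists 0; rewrite !linear0; split=> //.
  have -> : iter j e u = 0 by rewrite -(subnK Nj) iterD eN iter_lfun0.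
  by rewrite iter_lfun0.
have [|y [ey hy]] := IH j.+1; first by rewrite addnS.
set x := iter j e u; pose d := j.+1%:R * (nu + j%:R).
have hx : h x = (nu + (j.*2)%:R) *: x.
  by rewrite (sl2_weight_raise T) hu iter_lfunZ -scalerDl.
have d0 : d != 0 by rewrite mulf_neq0 ?pnatr_eq0 // gt_eqF // ltr_wpDr.
exists (d^-1 *: (iter j.+1 f x - y)); split.
  rewrite linearZ linearB /= -iterS (sl2_raise_lower T) ey -iterS.
  rewrite addrAC subrr add0r hx iter_lfunZ -scalerBl !scalerA.
  have dE : j.+1%:R * (nu + (j.*2)%:R - j%:R) = d.
    by rewrite -addnn natrD addrA addrK.
  by rewrite -mulrA dE mulVf // scale1r.
rewrite linearZ linearB /= -iterS (sl2_weight_lower T) hx iter_lfunZ hy.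
rewrite -scalerBl !scalerA [_ * d^-1]mulrC -!scalerA; congr (_ *: _).
rewrite scalerBr; congr (_ *: _ - _); rewrite doubleS -addn2 natrD; ring.
Qed.

(** By induction along the string of [v], the vector [e v] is an eigenvector, of
    eigenvalue [mu + 2 > 0]; hence [e v = e y] for an eigenvector [y] of
    eigenvalue [mu], and [v - y] falls under the case of [ker e]. *)
Lemma sl2_semisimple_ge0 mu v : 0 <= mu ->
  h (h v - mu *: v) = mu *: (h v - mu *: v) -> h v = mu *: v.
Proof.
case: (T) => he _ _ mu0 hw; have [N eNw] := sl2_raise_nilpotent T hw.
set w := h v - _ in hw eNw.
have hv : h v = mu *: v + w by rewrite addrC subrK.
have [M eM] : exists M, iter M e (iter N e v) = 0.
  apply: (sl2_raise_nilpotent T (mu := mu + (N.*2)%:R)).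
  by rewrite (sl2_weight_raise T) hv iter_lfunP eNw addr0 scalerDl.
rewrite -iterD in eM; move: (M + N)%N eM => n {M N eNw} env.
rewrite /w {w hv} in hw.
elim: n mu mu0 v hw env => [|n IH] mu mu0 v hw env.
  by rewrite (env : v = 0) linear0 scaler0.
have hev : h (e v) = (mu + 2) *: e v.
  have E : h (e v) - (mu + 2) *: e v = e (h v - mu *: v).
    rewrite he [(mu + 2) *: _]scalerDl opprD addrACA subrr addr0.
    by rewrite [RHS]linearB /= [e (mu *: v)]linearZ.
  apply: IH; [by rewrite addr_ge0| |by rewrite -iterSr].
  by rewrite E he hw linearZ /= -scalerDl.
have [||y [ey]] := @sl2_raise_surjective (mu + 2) (e v) => //.
  by rewrite ltr_wpDl.
rewrite addrK => hy.
suff : h (v - y) = mu *: (v - y).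
  by rewrite linearB /= hy scalerBr => /addIr.
apply: sl2_semisimple_ker; first by rewrite linearB /= ey subrr.
have E : h (v - y) - mu *: (v - y) = h v - mu *: v.
  by rewrite linearB /= hy scalerBr opprB addrA subrK.
by rewrite E.
Qed.

End Semisimple.

(** The eigenvalue [mu] is an integer, and exchanging [e] and [f] replaces it by
    [- mu]. *)
Lemma sl2_semisimple e f h mu v : sl2_triple e f h ->
  h (h v - mu *: v) = mu *: (h v - mu *: v) -> h v = mu *: v.
Proof.
move=> T hw; have [|w0] := eqVneq (h v - mu *: v) 0.
  by move=> /eqP; rewrite subr_eq0 => /eqP.
have [m [n muE]] := sl2_eigenvalue T w0 hw.
have [nm|mn] := leqP n m.
  by apply: (sl2_semisimple_ge0 T) hw; rewrite muE subr_ge0 ler_nat.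
apply: oppr_inj; rewrite -scaleNr -opp_lfunE.
apply: (sl2_semisimple_ge0 (sl2_triple_opp T)).
  by rewrite muE opprB subr_ge0 ler_nat ltnW.
have -> : (- h) v - - mu *: v = - (h v - mu *: v).
  by rewrite opp_lfunE scaleNr opprK opprB addrC.
by rewrite opp_lfunE linearN /= opprK hw scaleNr scalerN opprK.
Qed.

End Sl2.

(** * The Killing form and maximal abelian subalgebras *)

Section LieAlgebras.
Variables (K : fieldType) (g : lieAlgType K).
Implicit Types x y z : g.

Lemma linear_lie x : linear (lie x : g -> g).
Proof. exact: lie_linearr. Qed.

HB.instance Definition _ x := GRing.isLinear.Build K g g *:%R
  (lie x : g -> g) (linear_lie x).

Lemma linear_liel a x y z : lie (a *: x + y) z = a *: lie x z + lie y z.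
Proof. exact: lie_linearl. Qed.

Lemma adE x y : ad x y = lie x y. Proof. exact: lfunE. Qed.

Lemma lie_self x : lie x x = 0.
Proof. exact: liexx. Qed.

Lemma lie0l y : lie 0 y = 0.
Proof.
by have := linear_liel (-1) 0 0 y; rewrite scaler0 addr0 scaleN1r addNr.
Qed.

Lemma lieC x y : lie x y = - lie y x.
Proof.
have lieDl (u v w : g) : lie (v + w) u = lie v u + lie w u.
  by rewrite -[v]scale1r linear_liel !scale1r.
apply/eqP; rewrite -addr_eq0; have /eqP := lie_self (x + y).
by rewrite linearD /= !lieDl !lie_self add0r addr0 addrC.
Qed.

Lemma ad_linear : linear (@ad K g).
Proof.
move=> a x y; apply/lfunP => z.
by rewrite add_lfunE scale_lfunE !adE linear_liel.
Qed.

HB.instance Definition _ := GRing.isLinear.Build K g 'End(g) *:%R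
  (@ad K g) ad_linear.

Lemma ad_lie x y z : ad (lie x y) z = ad x (ad y z) - ad y (ad x z).
Proof.
rewrite !adE; have /eqP := lie_jacobi x y z.
rewrite [lie z (lie _ _)]lieC subr_eq0 => /eqP <-.
by rewrite [lie z x]lieC linearN.
Qed.

Lemma lie_derivation x y z :
  lie x (lie y z) = lie (lie x y) z + lie y (lie x z).
Proof. by have := ad_lie x y z; rewrite !adE => ->; rewrite subrK. Qed.

Lemma lieZl a x y : lie (a *: x) y = a *: lie x y.
Proof. by rewrite -[_ *: x]addr0 linear_liel lie0l addr0. Qed.

Lemma lieNl x y : lie (- x) y = - lie x y.
Proof. by rewrite -scaleN1r lieZl scaleN1r. Qed.

Definition ad_rep : lieRep g g := LieRep ad_linear ad_lie.

Lemma endo_traceC (V : vectType K) (f f' : 'End(V)) :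
  endo_trace (f \o f')%VF = endo_trace (f' \o f)%VF.
Proof.
by rewrite /endo_trace !(mxof_comp _ _ (vbasisP _)) mxtrace_mulC.
Qed.

Lemma endo_trace_linear (V : vectType K) : linear_for *%R (@endo_trace K V).
Proof. by move=> a f f'; rewrite /endo_trace !linearP. Qed.

HB.instance Definition _ (V : vectType K) :=
  GRing.isLinear.Build K 'End(V) K *%R (@endo_trace K V) (@endo_trace_linear V).

Lemma killingC x y : killing x y = killing y x.
Proof. exact: endo_traceC. Qed.

Lemma killing_linearr x : linear_for *%R (killing x).
Proof.
move=> a y z; rewrite /killing !linearP /=.
by rewrite comp_lfunDr -comp_lfunZr linearP.
Qed.

HB.instance Definition _ x := GRing.isLinear.Build K g K *%R
  (killing x) (killing_linearr x).

(** The ad-invariance of the Killing form is the cyclicity of the trace. *)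
Lemma killing_lie x y z : killing (lie x y) z = - killing y (lie x z).
Proof.
have adB (u v : g) : ad (lie u v) = (ad u \o ad v)%VF - (ad v \o ad u)%VF.
  by apply/lfunP => w; rewrite ad_lie add_lfunE opp_lfunE !comp_lfunE.
rewrite /killing !adB comp_lfunDl comp_lfunDr comp_lfunNl comp_lfunNr.
rewrite !linearB /= !comp_lfunA opprB; congr (_ - _).
by rewrite -comp_lfunA endo_traceC.
Qed.

(** A dimension count: the linear map sending [x] to the values of [killing x] on
    a basis of [Q] has rank at most [\dim Q < \dim W]. *)
Lemma killing_form_orthogonal (Q W : {vspace g}) : (Q <= W)%VS -> Q != W ->
  exists x, [/\ x \in W, x != 0 & forall q, q \in Q -> killing x q = 0].
Proof.
move=> QW nQW.
pose coords x : 'rV[K]_(\dim Q) := \row_j killing x (vbasis Q)`_j.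
have coords_linear : linear coords.
  move=> a x y; apply/rowP => j; rewrite !mxE -!(killingC (vbasis Q)`_j).
  by rewrite linearP.
pose coordsL : {linear g -> 'rV[K]_(\dim Q)} :=
  HB.pack coords (GRing.isLinear.Build _ _ _ _ coords coords_linear).
pose phi := linfun coordsL.
have phiE x j : phi x 0 j = killing x (vbasis Q)`_j by rewrite lfunE /= mxE.
have : (W :&: lker phi != 0)%VS.
  rewrite -dimv_eq0 -lt0n -(ltn_add2r (\dim (phi @: W))) limg_ker_dim add0n.
  apply: (@leq_ltn_trans (\dim Q)).
    by apply: (leq_trans (dimvS (subvf _))); rewrite dimvf /dim /= mul1n.
  rewrite ltn_neqAle dimvS // andbT; apply: contraNneq nQW => dQW.
  by rewrite eqEdim QW dQW leqnn.
rewrite -vpick0; set x := vpick _ => x0; exists x.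
have := memv_pick (W :&: lker phi).
rewrite memv_cap memv_ker => /andP[xW /eqP phix].
split=> // q /coord_vbasis ->; rewrite linear_sum big1 // => j _.
by rewrite linearZ /= -phiE phix mxE mulr0.
Qed.

(** The subspace [h + <[z]>] is an abelian subalgebra containing [h]. *)
Lemma mem_maximal_abelian (h : {vspace g}) z : maximal_abelian_subalgebra h ->
  (forall x, x \in h -> lie x z = 0) -> z \in h.
Proof.
move=> [hsub hab hmax] hz.
have ab : is_abelian (h + <[z]>)%VS.
  move=> x y /memv_addP[u uh [_ /vlineP[a ->] ->]].
  move=> /memv_addP[v vh [_ /vlineP[b ->] ->]] {x y}.
  have zv : lie z v = 0 by rewrite lieC hz // oppr0.
  rewrite addrC linear_liel ![v + _]addrC !linear_lie zv lie_self.
  rewrite (hab u v) // (hz u) //.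
  by rewrite !scaler0 !addr0 scaler0.
rewrite -(hmax _ _ ab (addvSl _ _)).
  by apply: (subvP (addvSr _ _)); exact: memv_line.
by move=> x y xk yk; rewrite ab // mem0v.
Qed.

End LieAlgebras.

Section Representations.
Variables (K : fieldType) (g : lieAlgType K) (V : vectType K).
Variable rho : lieRep g V.

HB.instance Definition _ := GRing.isLinear.Build K g 'End(V) *:%R
  (rep_act rho) (rep_linear rho).

Lemma rep_act0 v : rho 0 v = 0.
Proof. by rewrite linear0 zero_lfunE. Qed.

End Representations.

Lemma rep_sl2_triple (K : numFieldType) (g : lieAlgType K) (V : vectType K)
    (rho : lieRep g V) x y t : lie t x = 2 *: x -> lie t y = - (2 *: y) ->
  lie x y = t -> sl2_triple (rho x) (rho y) (rho t).
Proof.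
move=> tx ty xy; split=> v; apply/eqP; rewrite addrC -subr_eq.
- by rewrite -rep_lie tx linearZ /= scale_lfunE.
- by rewrite -rep_lie ty linearN linearZ /= !lfun_simp.
- by rewrite -rep_lie xy.
Qed.

(** * Skew endomorphisms *)

Section SkewOperators.
Variables (R : realFieldType) (U : vectType R) (b : U -> U -> R).
Hypothesis b_linear : forall a x y z, b (a *: x + y) z = a * b x z + b y z.
Hypothesis b_sym : forall x y, b x y = b y x.
Hypothesis b_neg : forall x, x != 0 -> b x x < 0.
Variables (A : 'End(U)) (F : 'End(cplx U)).
Hypothesis b_skew : forall x y, b (A x) y = - b x (A y).
Hypothesis FE : forall z, F z = Cplx (A (cre z)) (A (cim z)).

Let b0 z : b 0 z = 0.
Proof. by have := b_linear (-1) 0 0 z; rewrite scaler0 addr0 mulN1r addNr. Qed.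
Let bZ a x z : b (a *: x) z = a * b x z.
Proof. by rewrite -[_ *: _]addr0 b_linear b0 addr0. Qed.
Let bD x y z : b (x + y) z = b x z + b y z.
Proof. by rewrite -[x in LHS]scale1r b_linear mul1r. Qed.
Let bN x z : b (- x) z = - b x z.
Proof. by rewrite -scaleN1r bZ mulN1r. Qed.

Let b_norm_lt0 (z : cplx U) : z != 0 ->
  b (cre z) (cre z) + b (cim z) (cim z) < 0.
Proof.
move=> z0; have b_le0 x : b x x <= 0.
  by have [->|/b_neg/ltW//] := eqVneq x 0; rewrite b0.
have [re0|/b_neg re0] := eqVneq (cre z) 0; last by rewrite ltr_wnDr.
have im0 : cim z != 0 by apply: contra_neq z0 => im0; apply: cplxP.
by rewrite ltr_wnDl ?b_neg.
Qed.

Lemma skew_eigenvalue c z : z != 0 -> F z = c *: z -> complex.Re c = 0.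
Proof.
move=> z0; rewrite FE => -[]; set x := cre z; set y := cim z.
case: c => p q /= Ax Ay.
have bA u : b (A u) u = 0.
  have /eqP := b_skew u u.
  by rewrite [b u _]b_sym -addr_eq0 -mulr2n mulrn_eq0 => /eqP.
have := bA x; have := bA y; rewrite Ax Ay !bD bN !bZ (b_sym y x) => E1 E2.
have /eqP : p * (b x x + b y y) = 0 by lra.
by rewrite mulf_eq0 => /orP[/eqP//|]; rewrite lt_eqF // b_norm_lt0.
Qed.

(** Otherwise [w := F z - c *: z] is an eigenvector, [c] is imaginary, and
    [b w w = b (F z - c z) w = - b z (F w - c w) = 0] for the Hermitian
    extension of [b], which is still definite. *)
Lemma skew_semisimple c z :
  F (F z - c *: z) = c *: (F z - c *: z) -> F z = c *: z.
Proof.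
have [w wE] : exists w, w = F z - c *: z by eexists.
rewrite -wE => Fw; apply/eqP; rewrite -subr_eq0 -wE; apply/negPn/negP => w0.
have p0 := skew_eigenvalue w0 Fw; have nw := b_norm_lt0 w0.
move: Fw wE; rewrite !FE; case: c p0 => p q /= -> [].
rewrite !scale0r !sub0r !add0r => Aw1 Aw2 wE.
have w1E : cre w = A (cre z) + q *: cim z.
  by rewrite wE /= scale0r sub0r opprK.
have w2E : cim w = A (cim z) - q *: cre z by rewrite wE /= scale0r add0r.
have E1 : b (cre w) (cre w) = - b (cre z) (A (cre w)) + q * b (cim z) (cre w).
  by rewrite {1}w1E bD bZ b_skew.
have E2 : b (cim w) (cim w) = - b (cim z) (A (cim w)) - q * b (cre z) (cim w).
  by rewrite {1}w2E bD bN bZ b_skew.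
rewrite Aw1 [b _ (- _)]b_sym bN bZ (b_sym (cim w)) in E1.
rewrite Aw2 [b _ (_ *: _)]b_sym bZ (b_sym (cre w)) in E2.
by move: nw; rewrite E1 E2 (b_sym (cim z)); lra.
Qed.

End SkewOperators.

(** * Subalgebras su(2) of a compact Lie algebra *)

Section ComplexifiedAction.
Variables (R : rcfType) (g : lieAlgType R) (U : vectType R).
Variable rho : lieRep g U.
Implicit Types (x y t : g) (z : cplx U).

Lemma cplx_rep_real x z :
  cplx_rep rho (Cplx x 0) z = Cplx (rho x (cre z)) (rho x (cim z)).
Proof.
rewrite [LHS]cplx_rep_funE.
by apply: cplxP; rewrite /= rep_act0 ?subr0 ?addr0.
Qed.

Lemma cplx_rep_commute x y z : lie x y = 0 ->
  cplx_rep rho (Cplx x 0) (cplx_rep rho (Cplx y 0) z) =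
  cplx_rep rho (Cplx y 0) (cplx_rep rho (Cplx x 0) z).
Proof.
move=> xy; have C u : rho x (rho y u) = rho y (rho x u).
  by apply/eqP; rewrite -subr_eq0 -rep_lie xy rep_act0.
by rewrite !cplx_rep_real /= !C.
Qed.

(** A basis of a subalgebra su(2), normalized so that [x + iy] is a root vector
    of [t], of eigenvalue [ia], as is the case for the root vectors of a compact
    Lie algebra. *)
Definition su2_triple x y t := exists2 a : R, a != 0 &
  [/\ lie t x = - (a *: y), lie t y = a *: x & lie x y = t].

(** In the complexification of [g], the elements [x + iy], [(x - iy) / a] and
    [- 2it / a] satisfy the sl2 relations. *)
Lemma su2_triple_sl2 x y t : su2_triple x y t ->
  exists2 a : R, a != 0 & exists e f : 'End(cplx U),
    sl2_triple e f (Complex 0 a *: cplx_rep rho (Cplx t 0)).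
Proof.
move=> [a a0 [tx ty xy]]; pose c := - (2 / a).
exists c; first by rewrite oppr_eq0 mulf_neq0 ?invr_eq0 // pnatr_eq0.
exists (cplx_rep rho (Cplx x y)),
  (cplx_rep rho (Cplx (a^-1 *: x) (- (a^-1 *: y)))).
have -> : Complex 0 c *: cplx_rep rho (Cplx t 0)
    = cplx_rep rho (Cplx 0 (c *: t)).
  rewrite -linearZ /=; congr (cplx_rep_fun _ _); apply: cplxP => /=.
    by rewrite scale0r scaler0 subrr.
  by rewrite scale0r add0r.
have yx : lie y x = - t by rewrite lieC xy.
apply: rep_sl2_triple; apply: cplxP => /=;
  rewrite ?lie0l ?lieZl ?[lie x (- _)]linearN ?[lie y (- _)]linearN;
  rewrite ?[lie t (- _)]linearN /=;
  rewrite ?[lie _ (_ *: _)]linearZ /= ?tx ?ty ?xy ?yx ?lie_self;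
  apply: vcoordP => j;
  rewrite ?(vcoord0, vcoordD, vcoordN, vcoordZ) /c; by field.
Qed.

Lemma su2_triple_semisimple x y t mu z : su2_triple x y t ->
  let T := cplx_rep rho (Cplx t 0) in
  T (T z - mu *: z) = mu *: (T z - mu *: z) -> T z = mu *: z.
Proof.
move=> /su2_triple_sl2[a a0 [e [f]]] + T; rewrite -/T => S Tz.
have k0 : Complex 0 a != 0 by rewrite eq_complex /= negb_and a0 orbT.
apply: (scalerI k0); rewrite scalerA -scale_lfunE; apply: (sl2_semisimple S).
rewrite !scale_lfunE -scalerA -scalerBr [T (_ *: _)]linearZ /= Tz.
by rewrite !scalerA; congr (_ *: _); ring.
Qed.

Lemma su2_triple_eigenvalue x y t mu z : su2_triple x y t -> z != 0 ->
  cplx_rep rho (Cplx t 0) z = mu *: z -> complex.Re mu = 0.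
Proof.
move=> /su2_triple_sl2[a a0 [e [f S]]] z0 Tz.
have [|m [n E]] := sl2_eigenvalue S z0 (mu := Complex 0 a * mu).
  by rewrite scale_lfunE Tz scalerA.
move: E; rewrite -!(rmorph_nat (real_complex R)) -rmorphB.
move=> /(congr1 (@complex.Im R)); case: mu {Tz} => p q /=.
by rewrite mul0r add0r => /eqP; rewrite mulf_eq0 (negPf a0) => /eqP.
Qed.

End ComplexifiedAction.

(** If [Q] were proper, some nonzero [u] in [h] would be orthogonal to [Q], hence
    to [[x, y]] for every root vector [x + iy]. The relation
    [killing u [x, y] = - a * killing y y], where [[u, x] = - a y], then forces
    [[u, x + iy] = 0]. As the root vectors span with [h], [ad u = 0], which
    contradicts [killing u u < 0]. *)
Lemma su2_triples_span (R : rcfType) (g : lieAlgType R) (h Q : {vspace g}) :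
    compact_semisimple g -> maximal_abelian_subalgebra h -> (Q <= h)%VS ->
    (forall x y t, t \in h -> su2_triple x y t -> t \in Q) ->
  Q = h.
Proof.
move=> gc hmax Qh Qsu2; apply/eqP/negPn/negP => nQh.
have [_ hab _] := hmax.
have [u [uh u0 uQ]] := killing_form_orthogonal Qh nQh.
have kneg (x : g) : x != 0 -> killing x x < 0 by exact: gc.
have klin a (x y z : g) :
    killing (a *: x + y) z = a * killing x z + killing y z.
  by rewrite !(killingC _ z) linearP.
have kskew (v x y : g) : killing (ad_rep g v x) y = - killing x (ad_rep g v y).
  by rewrite /= !adE killing_lie.
pose F (v : g) := cplx_rep (ad_rep g) (Cplx v 0).
have FE v z : F v z = Cplx (ad_rep g v (cre z)) (ad_rep g v (cim z)).
  exact: cplx_rep_real.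
have Fu : lker (F u) = fullv.
  apply: (common_eigenvectors_span (F := fun v : subvs_of h => F (vsval v))).
  - move=> v w z; apply: cplx_rep_commute; apply: hab; exact: subvsP.
  - move=> v a z.
    exact: (skew_semisimple klin (@killingC _ _) kneg (kskew (vsval v)) (FE _)).
  move=> z z0 Fz; set x := cre z; set y := cim z.
  have Fz' v : v \in h -> exists a, lie v x = - (a *: y) /\ lie v y = a *: x.
    move=> vh; have [c Fc] := Fz (vsproj h v); rewrite /= vsprojK // in Fc.
    have c0 := skew_eigenvalue klin (@killingC _ _) kneg (kskew v) (FE _) z0 Fc.
    case: c Fc c0 => p q; rewrite FE => -[] /=; rewrite !adE => vx vy p0.
    by exists q; rewrite vx vy p0 !scale0r sub0r add0r.
  have th : lie x y \in h.
    apply: (mem_maximal_abelian hmax) => v /Fz'[a [vx vy]].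
    rewrite lie_derivation vx vy lieNl lieZl [lie x _]linearZ /= !lie_self.
    by rewrite !scaler0 oppr0 addr0.
  have kvt v a : lie v x = - (a *: y) ->
      killing v (lie x y) = - (a * killing y y).
    move=> vx; rewrite -[LHS]opprK -killing_lie lieC vx opprK.
    by rewrite killingC linearZ.
  have kut : killing u (lie x y) = 0.
    have [->|t0] := eqVneq (lie x y) 0; first by rewrite linear0.
    apply: uQ; have [a [tx ty]] := Fz' _ th; apply: (Qsu2 x y) => //.
    (* For [t := lie x y] one has [killing t t = - a * killing y y]. *)
    exists a => //; apply: contraTneq (kneg _ t0) => a0.
    by rewrite (kvt _ _ tx) a0 mul0r oppr0 ltxx.
  have [a [ux uy]] := Fz' u uh.
  rewrite memv_ker FE /= !adE -/x -/y ux uy.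
  have [y0|y0] := eqVneq y 0.
    by rewrite -uy y0 !linear0.
  have := kvt _ _ ux; rewrite kut => /esym/eqP.
  rewrite oppr_eq0 mulf_eq0 (lt_eqF (kneg _ y0)) orbF => /eqP ->.
  by rewrite !scale0r oppr0.
have := kneg u u0.
rewrite /killing (_ : ad u = 0) ?comp_lfun0r ?linear0 ?ltxx //.
apply/lfunP => x; have : Cplx x 0 \in lker (F u) by rewrite Fu memvf.
by rewrite memv_ker FE zero_lfunE => /eqP[].
Qed.

(** * Weights of a representation of a compact Lie algebra *)

Section Weights.
Variables (K : fieldType) (g : lieAlgType K) (V : vectType K).
Variables (rho : lieRep g V) (h : {vspace g}).
Implicit Types (l m : 'Hom(subvs_of h, K^o)) (v : V).

Lemma weight_sep l m : l != m -> exists x : subvs_of h, l x != m x.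
Proof.
move=> lm; apply: contrapT => /forallNP E; case/eqP: lm.
by apply/lfunP => x; apply/eqP/negPn/negP; exact: E.
Qed.

Lemma weight_spaceE l v : v \in weight_space rho l ->
  forall x : subvs_of h, rho (vsval x) v = l x *: v.
Proof. by move/mem_weight_space. Qed.

Lemma finite_nonzero_weights : finite_set (nonzero_weights rho h).
Proof.
apply: contrapT => /(@infinite_set_fset _ _ (\dim {:V}).+1)[B BL].
apply/negP; rewrite -leqNgt.
apply: (size_eigenspaces (F := fun x : subvs_of h => rho (vsval x))
  (w := fun l x => l x) weight_sep weight_spaceE); first exact: fset_uniq.
by move=> l /BL[].
Qed.

Lemma nonzero_weight_neq0 l : nonzero_weights rho h l -> l <> 0.
Proof. by move=> [/eqP]. Qed.

Lemma nonzero_weight_witness l v :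
  l <> 0 -> v != 0 -> v \in weight_space rho l -> nonzero_weights rho h l.
Proof.
move=> /eqP l0 v0 vl; split=> //.
by apply: contraNneq v0 => E; move: vl; rewrite E memv0.
Qed.

End Weights.

Section CompactWeights.
Variables (R : rcfType) (g : lieAlgType R) (U : vectType R).
Variables (rho : lieRep g U) (h : {vspace g}).
Implicit Types (z : cplx U) (l m : cplx_weight h) (s : seq (cplx_weight h)).

Local Notation V := (cplx_weight_space rho).
Local Notation Ur := (real_weight_space rho).
Local Notation U0 := (real_zero_weight_space rho h).

Definition cplx_conj z := Cplx (cre z) (- cim z).

Definition imaginary_weight_vector z := forall v, v \in h ->
  exists q : R, cplx_rep rho (Cplx v 0) z = Complex 0 q *: z.

(** It is enough to diagonalize the generators [t] in [h] of subalgebras su(2),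
    whose eigenvalues are imaginary: the [v] in [h] that act on a given vector
    by an imaginary scalar form a subspace. *)
Lemma imaginary_weight_vectors_span (S : {vspace cplx U}) :
    compact_semisimple g -> maximal_abelian_subalgebra h ->
    (forall z, z != 0 -> imaginary_weight_vector z -> z \in S) ->
  S = fullv.
Proof.
move=> gc hmax zS; have [_ hab _] := hmax.
pose I := {t : g | t \in h /\ exists x y, su2_triple x y t}.
apply: (common_eigenvectors_span
          (F := fun t : I => cplx_rep rho (Cplx (sval t) 0))).
- move=> [t [th _]] [t' [th' _]] z /=; apply: cplx_rep_commute; exact: hab.
- by move=> [t [_ [x [y xyt]]]] a z /=; exact: (su2_triple_semisimple xyt).
move=> z z0 Fz; apply: zS => // v vh.
pose P := [set v | v \in h /\
  exists q : R, cplx_rep rho (Cplx v 0) z = Complex 0 q *: z].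
have [P0 PD] : P 0 /\ forall a u v, P u -> P v -> P (a *: u + v).
  split; first split; first exact: mem0v.
    exists 0; rewrite [LHS](_ : _ = 0) ?scale0r //.
    by rewrite cplx_rep_real; apply: cplxP; rewrite /= rep_act0.
  move=> a u w [uh [q uq]] [wh [r wr]]; split; first by rewrite memvD ?memvZ.
  exists (a * q + r).
  have -> : Cplx (a *: u + w) 0 = Complex a 0 *: Cplx u 0 + Cplx w 0.
    by apply: cplxP; rewrite /= ?scaler0 ?scale0r ?subr0 ?addr0.
  rewrite linearP add_lfunE scale_lfunE uq wr scalerA -scalerDl.
  congr (_ *: _); apply/eqP; rewrite eq_complex /=.
  by apply/andP; split; apply/eqP; ring.
have Qh : vspace_of P = h.
  apply: (su2_triples_span gc hmax).
    by apply/subvP => x /(mem_vspace_of P0 PD)[].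
  move=> x y t th xyt; apply/(mem_vspace_of P0 PD); split=> //.
  have [mu Tz] := Fz (exist _ t (conj th (ex_intro _ x (ex_intro _ y xyt)))).
  have := su2_triple_eigenvalue xyt z0 Tz; case: mu Tz => p q /= Tz p0.
  by exists q; rewrite Tz p0.
by move: vh; rewrite -{1}Qh => /(mem_vspace_of P0 PD)[].
Qed.

Lemma cplx_rep_split x z : cplx_rep rho x z =
  cplx_rep rho (Cplx (cre x) 0) z
    + Complex 0 1 *: cplx_rep rho (Cplx (cim x) 0) z.
Proof.
rewrite -scale_lfunE -add_lfunE -linearZ -linearD; congr (cplx_rep_fun _ _ _).
by apply: cplxP; rewrite /= ?scale0r ?scaler0 ?scale1r ?subr0 ?addr0 ?add0r.
Qed.

(** The complex-linear extension of an imaginary-valued functional changes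
    sign under conjugation. *)
Lemma imaginary_weight_vectorP z : z != 0 -> imaginary_weight_vector z ->
  exists2 l : cplx_weight h, z \in V l & cplx_conj z \in V (- l).
Proof.
move=> z0 zI.
have /choice[q qE] (v : subvs_of h) : exists q : R,
    cplx_rep rho (Cplx (vsval v) 0) z = Complex 0 q *: z.
  by apply: zI; exact: subvsP.
pose c (x : subvs_of (cplx_subspace h)) : R[i]^o :=
  Complex (- q (vsproj h (cim (vsval x)))) (q (vsproj h (cre (vsval x)))).
have reh (x : subvs_of (cplx_subspace h)) : cre (vsval x) \in h.
  by have /mem_cplx_subspace[] := subvsP x.
have imh (x : subvs_of (cplx_subspace h)) : cim (vsval x) \in h.
  by have /mem_cplx_subspace[] := subvsP x.
have cE x : cplx_rep rho (vsval x) z = c x *: z.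
  rewrite cplx_rep_split.
  have := qE (vsproj h (cre (vsval x))); rewrite vsprojK // => ->.
  have := qE (vsproj h (cim (vsval x))); rewrite vsprojK // => ->.
  rewrite scalerA -scalerDl; congr (_ *: _).
  by apply/eqP; rewrite eq_complex /= !mul0r !mul1r !addr0 !add0r !eqxx.
have c_linear : linear c.
  move=> a x y; apply/eqP; rewrite -subr_eq0.
  suff /eqP : (c (a *: x + y) - (a *: c x + c y)) *: z = 0.
    by rewrite scaler_eq0 (negPf z0) orbF.
  rewrite scalerBl -cE [vsval _]linearP [cplx_rep rho _]linearP.
  rewrite add_lfunE scale_lfunE !cE.
  by rewrite scalerDl scalerA subrr.
pose cL : {linear subvs_of (cplx_subspace h) -> R[i]^o} :=
  HB.pack c (GRing.isLinear.Build _ _ _ _ c c_linear).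
exists (linfun cL); apply/mem_weight_space => x; first by rewrite cE lfunE.
have conjE v a : cplx_rep rho (Cplx v 0) z = Complex 0 a *: z ->
    cplx_rep rho (Cplx v 0) (cplx_conj z) = Complex 0 (- a) *: cplx_conj z.
  rewrite !cplx_rep_real => -[E1 E2]; apply: cplxP => /=.
    by rewrite E1 !scale0r scalerN scaleNr opprK.
  by rewrite linearN /= E2 !scale0r !add0r scaleNr.
rewrite cplx_rep_split opp_lfunE [linfun cL x]lfunE.
have /conjE := qE (vsproj h (cre (vsval x))); rewrite vsprojK // => ->.
have /conjE := qE (vsproj h (cim (vsval x))); rewrite vsprojK // => ->.
rewrite scalerA -scalerDl; congr (_ *: _).
by apply/eqP; rewrite eq_complex /= !mul0r !mul1r !addr0 !add0r !eqxx.
Qed.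

Lemma real_subspace_parts (W : {vspace cplx U}) z :
  z \in W -> cplx_conj z \in W ->
  cre z \in real_subspace W /\ cim z \in real_subspace W.
Proof.
move=> zW cW; split; apply/mem_real_subspace.
  have -> : Cplx (cre z) 0 = Complex 2^-1 0 *: (z + cplx_conj z).
    apply: cplxP; rewrite /= !scale0r ?subrr ?scaler0 ?addr0 // subr0.
    by rewrite -mulr2n -scaler_nat scalerA mulVf ?scale1r // pnatr_eq0.
  by rewrite memvZ ?memvD.
have -> : Cplx (cim z) 0 = Complex 0 (- 2^-1) *: (z - cplx_conj z).
  apply: cplxP; rewrite /= !scale0r ?subrr ?scaler0 ?addr0 //.
  rewrite sub0r opprK scaleNr opprK -mulr2n -scaler_nat scalerA.
  by rewrite mulVf ?scale1r // pnatr_eq0.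
by rewrite memvZ ?memvB.
Qed.

Lemma real_weight_spaceN l : Ur (- l) = Ur l.
Proof. by rewrite /real_weight_space opprK addvC. Qed.

Lemma real_weight_space_parts l z : z \in V l -> cplx_conj z \in V (- l) ->
  cre z \in Ur l /\ cim z \in Ur l.
Proof.
move=> zl zNl; apply: real_subspace_parts; first exact: (subvP (addvSl _ _)).
exact: (subvP (addvSr _ _)).
Qed.

Lemma cplx_weight_neq0 l : cplx_weights rho h l -> l <> 0.
Proof. exact: nonzero_weight_neq0. Qed.

Lemma cplx_weight_witness l z :
  l <> 0 -> z != 0 -> z \in V l -> cplx_weights rho h l.
Proof. exact: nonzero_weight_witness. Qed.

Lemma finite_cplx_weights : finite_set (cplx_weights rho h).
Proof. exact: finite_nonzero_weights. Qed.

Lemma cplx_weight_sep l m : l != m ->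
  exists x : subvs_of (cplx_subspace h), l x != m x.
Proof. exact: weight_sep. Qed.

Lemma cplx_weight_spaceE l z : z \in V l ->
  forall x : subvs_of (cplx_subspace h), cplx_rep rho (vsval x) z = l x *: z.
Proof. exact: weight_spaceE. Qed.

Lemma cplx_mem_sum_weights s u : u \in (\sum_(l <- s) Ur l)%VS ->
  Cplx u 0 \in (\sum_(l <- s ++ map -%R s) V l)%VS.
Proof.
move=> us; apply/mem_real_subspace; move: u us.
apply/subvP/sum_seq_subv => l ls.
apply/subvP => u /mem_real_subspace ul; apply/mem_real_subspace; move: ul.
apply/subvP; rewrite subv_add !subv_sum_seq // mem_cat ?ls //.
by rewrite map_f ?orbT.
Qed.

Lemma real_zero_weight_disjoint s : (0 : cplx_weight h) \notin s ->
  (U0 :&: \sum_(l <- s) Ur l = 0)%VS.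
Proof.
move=> s0; apply/eqP; rewrite -subv0; apply/subvP => u; rewrite memv_cap memv0.
move=> /andP[/mem_real_subspace uV /cplx_mem_sum_weights us].
have [->] : Cplx u 0 = 0 :> cplx U; last by [].
apply: (eigenvector_notin_sum cplx_weight_sep cplx_weight_spaceE (l := 0)) us.
  rewrite mem_cat negb_or s0; apply: contra s0 => /mapP[l ls /eqP].
  by rewrite eq_sym oppr_eq0 => /eqP <-.
exact: cplx_weight_spaceE.
Qed.

(** If [u] is the sum of [z] in [V l] and [z'] in [V (- l)], then [z] is a
    combination of vectors of weight [- l] and of weights [m] and [- m] with
    [m] in [s], so it is zero, and symmetrically so is [z']. *)
Lemma real_weight_disjoint s l : l != 0 -> l \notin s -> - l \notin s ->
  (Ur l :&: \sum_(m <- s) Ur m = 0)%VS.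
Proof.
move=> l0 ls Nls; apply/eqP; rewrite -subv0; apply/subvP => u.
rewrite memv_cap memv0 => /andP[/mem_real_subspace uV /cplx_mem_sum_weights us].
have [z zV [z' zV' uE]] := memv_addP uV.
have lNl k : k != 0 -> k != - k :> cplx_weight h.
  move=> k0; rewrite -subr_eq0 opprK -mulr2n -scaler_nat.
  by rewrite scaler_eq0 pnatr_eq0.
have notin k : k != 0 -> k \notin s -> - k \notin s ->
    k \notin - k :: (s ++ map -%R s).
  move=> k0 ks Nks; rewrite inE negb_or lNl // mem_cat negb_or ks /=.
  by apply: contra Nks => /mapP[m ms ->]; rewrite opprK.
have zero k w w' : k != 0 -> k \notin s -> - k \notin s -> w \in V k ->
    w' \in V (- k) -> Cplx u 0 = w + w' -> w = 0.
  move=> k0 ks Nks wV wV' uww.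
  apply: (eigenvector_notin_sum cplx_weight_sep cplx_weight_spaceE
    (notin k k0 ks Nks)); first exact: cplx_weight_spaceE.
  have -> : w = - w' + Cplx u 0 by rewrite uww addrC addrK.
  by rewrite big_cons memv_add // memvN.
have z0 : z = 0 by apply: (zero l z z').
have z'0 : z' = 0.
  by apply: (zero (- l) z' z) => //; rewrite ?oppr_eq0 ?opprK // addrC.
by move: uE; rewrite z0 z'0 addr0 => -[->].
Qed.

End CompactWeights.

(** * Orthogonality *)

Section Orthogonality.
Variables (R : rcfType) (g : lieAlgType R) (U : vectType R).
Variables (rho : lieRep g U) (h : {vspace g}) (ip : {dot U for idfun}).
Hypothesis ip_skew : skew_module rho ip.
Implicit Types (z w : cplx U) (l m : cplx_weight h).

Let ipDl (u v w : U) : ip (u + v) w = ip u w + ip v w.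
Proof. exact: linearDl. Qed.
Let ipDr (u v w : U) : ip u (v + w) = ip u v + ip u w.
Proof. exact: linearDr. Qed.
Let ipNl u v : ip (- u) v = - ip u v. Proof. exact: linearNl. Qed.
Let ipNr u v : ip u (- v) = - ip u v. Proof. exact: linearNr. Qed.
Let ipZl a u v : ip (a *: u) v = a * ip u v. Proof. exact: linearZl_LR. Qed.
Let ipZr a u v : ip u (a *: v) = a * ip u v. Proof. exact: linearZr_LR. Qed.

(** The extension is R[i]-bilinear rather than Hermitian, so that the whole
    complexification of [g] is skew for it, and not only its real form. *)
Definition cplx_form z w : R[i] :=
  Complex (ip (cre z) (cre w) - ip (cim z) (cim w))
          (ip (cre z) (cim w) + ip (cim z) (cre w)).

Lemma cplx_formDl z z' w :
  cplx_form (z + z') w = cplx_form z w + cplx_form z' w.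
Proof.
by apply/eqP; rewrite eq_complex /= !ipDl; apply/andP; split; apply/eqP; ring.
Qed.

Lemma cplx_formDr z w w' :
  cplx_form z (w + w') = cplx_form z w + cplx_form z w'.
Proof.
by apply/eqP; rewrite eq_complex /= !ipDr; apply/andP; split; apply/eqP; ring.
Qed.

Lemma cplx_formZl a z w : cplx_form (a *: z) w = a * cplx_form z w.
Proof.
case: a => p q; apply/eqP; rewrite eq_complex /= !(ipDl, ipNl, ipZl).
by apply/andP; split; apply/eqP; ring.
Qed.

Lemma cplx_formZr a z w : cplx_form z (a *: w) = a * cplx_form z w.
Proof.
case: a => p q; apply/eqP; rewrite eq_complex /= !(ipDr, ipNr, ipZr).
by apply/andP; split; apply/eqP; ring.
Qed.

Lemma cplx_form_skew x z w :
  cplx_form (cplx_rep rho x z) w = - cplx_form z (cplx_rep rho x w).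
Proof.
rewrite !(cplx_rep_funE rho); apply/eqP; rewrite eq_complex /=.
rewrite !(ipDl, ipNl, ipDr, ipNr) !ip_skew.
by apply/andP; split; apply/eqP; ring.
Qed.

(** Invariance gives [(l x + m x) * cplx_form z w = 0] for all [x]. *)
Lemma cplx_weight_spaces_orthogonal l m z w : l != - m ->
  z \in cplx_weight_space rho l -> w \in cplx_weight_space rho m ->
  cplx_form z w = 0.
Proof.
move=> /cplx_weight_sep[x lm] zl wm; have := cplx_form_skew (vsval x) z w.
rewrite (cplx_weight_spaceE zl) (cplx_weight_spaceE wm) cplx_formZl cplx_formZr.
move=> /eqP; rewrite -mulNr -subr_eq0 -mulrBl mulf_eq0 subr_eq0.
by rewrite opp_lfunE in lm; rewrite (negPf lm) => /eqP.
Qed.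

Lemma real_subspaces_orthogonal (A B : {vspace cplx U}) :
  (forall z w, z \in A -> w \in B -> cplx_form z w = 0) ->
  orthogonal_subspaces ip (real_subspace A) (real_subspace B).
Proof.
move=> AB u v /mem_real_subspace uA /mem_real_subspace vB.
have := AB _ _ uA vB; rewrite /cplx_form /= => -[+ _].
by rewrite [X in _ - X](linear0r ip) subr0.
Qed.

Lemma real_zero_weight_orthogonal l : l <> 0 ->
  orthogonal_subspaces ip (real_zero_weight_space rho h)
    (real_weight_space rho l).
Proof.
move=> /eqP l0; apply: real_subspaces_orthogonal => z w z0.
move=> /memv_addP[w1 w1l [w2 w2l ->]]; rewrite cplx_formDr.
rewrite (cplx_weight_spaces_orthogonal _ z0 w1l) 1?eq_sym ?oppr_eq0 //.
by rewrite (cplx_weight_spaces_orthogonal _ z0 w2l) ?addr0 // opprK eq_sym.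
Qed.

Lemma real_weight_spaces_orthogonal l m : l <> m -> l <> - m ->
  orthogonal_subspaces ip (real_weight_space rho l) (real_weight_space rho m).
Proof.
move=> /eqP lm /eqP lNm; apply: real_subspaces_orthogonal => z w.
move=> /memv_addP[z1 z1l [z2 z2l ->]] /memv_addP[w1 w1m [w2 w2m ->]].
rewrite !cplx_formDl !cplx_formDr.
rewrite (cplx_weight_spaces_orthogonal _ z1l w1m) //.
rewrite (cplx_weight_spaces_orthogonal _ z1l w2m) ?opprK //.
rewrite (cplx_weight_spaces_orthogonal _ z2l w1m); last first.
  by apply: contra_neq lm => /oppr_inj.
by rewrite (cplx_weight_spaces_orthogonal _ z2l w2m) ?addr0 // opprK eqr_oppLR.
Qed.

End Orthogonality.

(** * The real weight space decomposition *)

Theorem proposition6p4 (R : realType) (g0 : lieAlgType R)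
  (g0_compact : compact_semisimple g0)
  (U : vectType R) (rho : lieRep g0 U)
  (h0 : {vspace g0}) (h0_max : maximal_abelian_subalgebra h0)
  (Lp : set (cplx_weight h0))
  (Lp_cover : cplx_weights rho h0 = Lp `|` [set - l | l in Lp])
  (Lp_disj : Lp `&` [set - l | l in Lp] = set0) :
  [/\ finite_set Lp,
      {:U}%VS = (real_zero_weight_space rho h0
                 + \sum_(l <- fset_set Lp) real_weight_space rho l)%VS,
      directv (real_zero_weight_space rho h0
               + \sum_(l <- fset_set Lp) real_weight_space rho l) &
      forall ip : {dot U for idfun}, skew_module rho ip ->
        (forall l, Lp l ->
           orthogonal_subspaces ip (real_zero_weight_space rho h0)
                                   (real_weight_space rho l)) /\
        (forall l m, Lp l -> Lp m -> l <> m ->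
           orthogonal_subspaces ip (real_weight_space rho l)
                                   (real_weight_space rho m))].
Proof.
have LpL l : Lp l -> cplx_weights rho h0 l by rewrite Lp_cover; left.
have Lp0 l : Lp l -> l <> 0 by move=> /LpL/cplx_weight_neq0.
have LpN l m : Lp l -> Lp m -> l <> - m.
  move=> ll mm lm; suff : (set0 : set (cplx_weight h0)) l by [].
  by rewrite -Lp_disj; split=> //; exists m.
have Lpfin : finite_set Lp.
  by apply: sub_finite_set (finite_cplx_weights rho h0).
have inLp l : (l \in fset_set Lp) = `[< Lp l >].
  by rewrite in_fset_set // asboolE.
set s := fset_set Lp in inLp *.
split=> //.
- set S := (_ + _)%VS.
  have SN l : cplx_weights rho h0 l -> (real_weight_space rho l <= S)%VS.
    rewrite Lp_cover => -[ll|[m mm <-]]; rewrite ?real_weight_spaceN;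
      apply: (subv_trans _ (addvSr _ _));
      by apply: subv_sum_seq; rewrite inLp; apply/asboolP.
  (* The complexification of [S] can be tested on weight vectors, whose real and
     imaginary parts are in the real weight spaces. *)
  have CS : cplx_subspace S = fullv.
    apply: (imaginary_weight_vectors_span (rho := rho) g0_compact h0_max).
    move=> z z0 /(imaginary_weight_vectorP z0)[l zl zNl].
    apply/mem_cplx_subspace.
    have [l0|l0] := pselect (l = 0).
      rewrite l0 oppr0 in zl zNl.
      have [re im] := real_subspace_parts zl zNl.
      by split; apply: (subvP (addvSl _ _)).
    have ll := cplx_weight_witness l0 z0 zl.
    have [re im] := real_weight_space_parts zl zNl.
    by split; apply: (subvP (SN l ll)).
  apply/eqP; rewrite eqEsubv subvf andbT; apply/subvP => u _.
  by have /mem_cplx_subspace[] : Cplx u 0 \in cplx_subspace S;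
    rewrite ?CS ?memvf.
- rewrite directvE /= dimv_disjoint_sum; last first.
    apply: real_zero_weight_disjoint; rewrite inLp.
    by apply/asboolP => /Lp0.
  rewrite eqn_add2l.
  suff dimE (r : seq (cplx_weight h0)) : uniq r -> {subset r <= s} ->
      \dim (\sum_(l <- r) real_weight_space rho l) ==
      (\sum_(l <- r) \dim (real_weight_space rho l))%N.
    exact: dimE (fset_uniq s) _.
  elim: r => [|l r IH]; first by rewrite !big_nil dimv0.
  rewrite cons_uniq => /andP[lr ur] rs; rewrite !big_cons.
  have ll : Lp l by apply/asboolP; rewrite -inLp rs ?mem_head.
  have rs' : {subset r <= s} by move=> m mr; rewrite rs // inE mr orbT.
  rewrite dimv_disjoint_sum ?eqn_add2l ?IH //.
  apply: real_weight_disjoint => //; first exact/eqP/Lp0.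
  apply/negP => /rs'; rewrite inLp => /asboolP /(LpN l _ ll); apply.
  by rewrite opprK.
move=> ip ip_skew; split=> [l /Lp0 l0|l m ll mm lm].
  exact: real_zero_weight_orthogonal.
by apply: real_weight_spaces_orthogonal => //; exact: LpN.
Qed.
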